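(* The map $\Phi$ is a bijection from $\mathcal{N}_{n,1}$ onto $\mathcal{M}_{n,1}$.
   Context: An alternating sign matrix (ASM) of order $n$ is an $n\times n$ matrix $A=(a_{ij})$ with entries in $\{-1,0,1\}$ such that in every row and every column the nonzero entries alternate in sign, the first and the last nonzero entries being $1$. $\mathcal{A}_{n,1}$ denotes the set of order-$n$ ASMs having exactly one entry equal to $-1$. Let $A\in\mathcal{A}_{n,1}$. The opening column is the column containing the unique $-1$; the closing row is the row containing the $-1$; the opening row is the row of the $1$ of the opening column lying above the $-1$. The columns strictly to the left (resp. right) of the opening column form the left side (resp. right side). The closing row contains exactly two $1$'s, one in each side; the one in the right side is the closing $1$ and its column is the closing column. $A$ is neutral if the closing row is the row immediately below the opening row; $\mathcal{A}_{n,1}^{0}$ denotes the set of neutral elements of $\mathcal{A}_{n,1}$. For $N\in\mathcal{A}_{n,1}^{0}$: the leading $1$ is the highest $1$ in the left side strictly below the opening row; its column is the leading column; the leading cell consists of the entries strictly below the opening row and strictly between the leading column and the opening column, and $\ell(N)$ is the sum of its entries. The closing cell consists of the entries strictly below the closing row and strictly between the opening column and the closing column, and $c(N)$ is the sum of its entries. $\mathcal{N}_{n,1}=\{(N,E)\,:\,N\in\mathcal{A}_{n,1}^{0},\ E\in\mathbb{Z},\ -\ell(N)\le E\le c(N)\}$. Generalized inversion table: for $(N,E)\in\mathcal{N}_{n,1}$, let $n+1-k$ be the index of the opening row of $N$ (so the closing row is row $n+2-k$). For $1\le i\le n$, $a_i$ is the sum of the entries of $N$ lying strictly below row $n+1-i$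 and strictly to the left of the unique $1$ of row $n+1-i$ (for $i=k-1$, i.e. the closing row, the leftmost $1$ of that row is used). Let $b=c(N)$ and $\beta=E+\ell(N)$. The generalized inversion table of $(N,E)$ is $(k;a_1,\dots,a_n;b,\beta)$. Mixed configurations: let $\mathcal{G}_n=\{(x,y)\in\mathbb{Z}^2: 0\le x<y\le n\}$. Steps are $E=(1,0)$, $F=(1,0)$ (a distinct letter from $E$ with the same displacement), $S=(0,-1)$, $N=(1,1)$. A mixed path is a lattice path all of whose vertices lie in $\mathcal{G}_n$, given as a word $LR$ where the Left part $L$ is a word in $\{S,E\}$ and the Right part $R$ is a word in $\{F,N\}$; the vertex where $L$ ends and $R$ begins is the junction. An order-$n$ mixed configuration is a sequence $(\omega_1,\dots,\omega_n)$ of mixed paths such that for some permutation $\sigma$ of $\{1,\dots,n\}$, $\omega_i$ starts at $(0,i)$ and ends at $(\sigma(i)-1,\sigma(i))$, the Left parts are pairwise vertex-disjoint, and the Right parts are pairwise vertex-disjoint. $\mathcal{M}_{n,s}$ is the set of order-$n$ mixed configurations containing exactly $s$ $N$-steps in total. For $(N,E)\in\mathcal{N}_{n,1}$ with generalized inversion table $(k;a_1,\dots,a_n;b,\beta)$, $\Phi(N,E)=(\omega_1,\dots,\omega_n)$ where $\omega_i=E^{a_i}F^{i-1-a_i}$ for $i\notin\{k-1,k\}$, $\omega_{k-1}=E^{a_{k-1}}F^{\beta}NF^{k-2-a_{k-1}-\beta}$, and $\omega_k=E^{a_k}SE^{b}F^{k-2-a_k-b}$ (exponents denote repetition of steps;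 $\omega_i$ starts at $(0,i)$). *)

(* Defs.v *)
From HB Require Import structures.
From mathcomp Require Import all_boot all_order all_algebra all_fingroup.
Set Implicit Arguments. Unset Strict Implicit. Unset Printing Implicit Defensive.
Import Order.TTheory GRing.Theory Num.Theory.
Local Open Scope ring_scope.

(* ent A r c = entry in row r, column c (1-based, 1 <= r,c <= n); 0 outside. *)
Definition ent (n : nat) (A : 'M[int]_n) (r c : nat) : int :=
  match (insub r.-1 : option 'I_n), (insub c.-1 : option 'I_n) with
  | Some i, Some j => if ((0 < r)%N && (0 < c)%N) then A i j else 0
  | _, _ => 0
  end.

Definition row_nz n (A : 'M[int]_n) (r : nat) : seq int :=
  [seq x <- [seq ent A r c | c <- iota 1 n] | x != 0].
Definition col_nz n (A : 'M[int]_n) (c : nat) : seq int :=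
  [seq x <- [seq ent A r c | r <- iota 1 n] | x != 0].

Definition alternating (s : seq int) : bool :=
  match s with
  | [::] => false
  | x :: t => [&& x == 1, last x t == 1 & path (fun a b => b == - a) x t]
  end.

Definition is_ASM n (A : 'M[int]_n) : bool :=
  [&& [forall i : 'I_n, forall j : 'I_n, A i j \in [:: -1; 0; 1]],
      all (fun r => alternating (row_nz A r)) (iota 1 n) &
      all (fun c => alternating (col_nz A c)) (iota 1 n)].

Definition in_A1 n (A : 'M[int]_n) : bool :=
  is_ASM A && (#|[set p : 'I_n * 'I_n | A p.1 p.2 == -1]| == 1%N).

(* least x in 1..n satisfying P (n+1 if none) *)
Definition first_in (n : nat) (P : pred nat) : nat := (find P (iota 1 n)).+1.

Definition closing_row n (A : 'M[int]_n) : nat :=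
  first_in n (fun r => has (fun c => ent A r c == -1) (iota 1 n)).
Definition opening_col n (A : 'M[int]_n) : nat :=
  first_in n (fun c => ent A (closing_row A) c == -1).
Definition opening_row n (A : 'M[int]_n) : nat :=
  first_in n (fun r => (r < closing_row A)%N && (ent A r (opening_col A) == 1)).
Definition closing_col n (A : 'M[int]_n) : nat :=
  first_in n (fun c => (opening_col A < c)%N && (ent A (closing_row A) c == 1)).
Definition neutral n (A : 'M[int]_n) : bool :=
  closing_row A == (opening_row A).+1.
Definition leading_row n (A : 'M[int]_n) : nat :=
  first_in n (fun r => (opening_row A < r)%N &&
    has (fun c => (c < opening_col A)%N && (ent A r c == 1)) (iota 1 n)).
Definition leading_col n (A : 'M[int]_n) : nat :=
  first_in n (fun c => (c < opening_col A)%N && (ent A (leading_row A) c == 1)).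

Definition sum_below_between n (A : 'M[int]_n) (r c1 c2 : nat) : int :=
  \sum_(r' <- iota r.+1 (n - r)) \sum_(c <- iota c1.+1 (c2 - c1.+1)) ent A r' c.

Definition ell n (A : 'M[int]_n) : int :=
  sum_below_between A (opening_row A) (leading_col A) (opening_col A).
Definition cval n (A : 'M[int]_n) : int :=
  sum_below_between A (closing_row A) (opening_col A) (closing_col A).

Definition in_N n (A : 'M[int]_n) (E : int) : bool :=
  [&& in_A1 A, neutral A & (- ell A <= E <= cval A)].

Definition kk n (A : 'M[int]_n) : nat := (n.+1 - opening_row A)%N.
Definition col1 n (A : 'M[int]_n) (r : nat) : nat := first_in n (fun c => ent A r c == 1).
Definition ainv n (A : 'M[int]_n) (i : nat) : int :=
  sum_below_between A (n.+1 - i) 0 (col1 A (n.+1 - i)).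
Definition bval n (A : 'M[int]_n) : int := cval A.
Definition beta n (A : 'M[int]_n) (E : int) : int := E + ell A.

Inductive step := sE | sF | sS | sN.

Definition rep (m : int) (s : step) : seq step := nseq `|m|%N s.

Definition exps n (A : 'M[int]_n) (E : int) (i : nat) : seq int :=
  let k := kk A in
  if i == k.-1 then [:: ainv A i; beta A E; k%:Z - 2 - ainv A i - beta A E]
  else if i == k then [:: ainv A i; bval A; k%:Z - 2 - ainv A i - bval A]
  else [:: ainv A i; i%:Z - 1 - ainv A i].

Definition word n (A : 'M[int]_n) (E : int) (i : nat) : seq step :=
  let k := kk A in
  if i == k.-1 then
    rep (ainv A i) sE ++ rep (beta A E) sF ++ sN :: rep (k%:Z - 2 - ainv A i - beta A E) sF
  else if i == k then
    rep (ainv A i) sE ++ sS :: rep (bval A) sE ++ rep (k%:Z - 2 - ainv A i - bval A) sF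
  else rep (ainv A i) sE ++ rep (i%:Z - 1 - ainv A i) sF.

(* Phi is defined (Some) exactly when all exponents are nonnegative;
   the i-th element of the list is omega_i (i = 1..n). *)
Definition Phi n (A : 'M[int]_n) (E : int) : option (seq (seq step)) :=
  if all (fun i => all (fun x => 0 <= x) (exps A E i)) (iota 1 n)
  then Some [seq word A E i | i <- iota 1 n] else None.

Definition pt := (int * int)%type.

Definition move (p : pt) (s : step) : pt :=
  match s with
  | sE | sF => (p.1 + 1, p.2)
  | sS => (p.1, p.2 - 1)
  | sN => (p.1 + 1, p.2 + 1)
  end.

Definition verts (p : pt) (w : seq step) : seq pt := p :: scanl move p w.
Definition endp (p : pt) (w : seq step) : pt := foldl move p w.

Definition isLeft (s : step) : bool := if s is sE then true else if s is sS then true else false.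
Definition isN (s : step) : bool := if s is sN then true else false.

(* unique decomposition w = L R with L in {S,E}^*, R beginning with F or N *)
Definition lpart (w : seq step) : seq step := take (find (fun s => ~~ isLeft s) w) w.
Definition rpart (w : seq step) : seq step := drop (find (fun s => ~~ isLeft s) w) w.
Definition junction (p : pt) (w : seq step) : pt := endp p (lpart w).

Definition lverts (p : pt) (w : seq step) : seq pt := verts p (lpart w).
Definition rverts (p : pt) (w : seq step) : seq pt := verts (junction p w) (rpart w).

Definition inG (n : nat) (p : pt) : bool := [&& 0 <= p.1, p.1 < p.2 & p.2 <= n%:Z].

Definition mixed_path (n : nat) (p : pt) (w : seq step) : bool :=
  all (fun s => ~~ isLeft s) (rpart w) && all (inG n) (verts p w).

Definition start (i : nat) : pt := (0, i%:Z).

(* ws = [:: omega_1; ...; omega_n] *)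
Definition mixed_config (n : nat) (ws : seq (seq step)) : Prop :=
  [/\ size ws = n,
      forall i : 'I_n, mixed_path n (start i.+1) (nth [::] ws i),
      exists sigma : {perm 'I_n}, forall i : 'I_n,
        endp (start i.+1) (nth [::] ws i) = ((sigma i)%:Z, (sigma i).+1%:Z),
      forall i j : 'I_n, i != j ->
        ~~ has (fun v => v \in lverts (start j.+1) (nth [::] ws j))
               (lverts (start i.+1) (nth [::] ws i)) &
      forall i j : 'I_n, i != j ->
        ~~ has (fun v => v \in rverts (start j.+1) (nth [::] ws j))
               (rverts (start i.+1) (nth [::] ws i))].

Definition num_N (ws : seq (seq step)) : nat := sumn [seq count isN w | w <- ws].

Definition in_M (n s : nat) (ws : seq (seq step)) : Prop :=
  mixed_config n ws /\ num_N ws = s.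

(* Main.v *)
Require Import Defs.
From HB Require Import structures.
From mathcomp Require Import all_boot all_order all_algebra all_fingroup.
From mathcomp Require Import zify.
Set Implicit Arguments. Unset Strict Implicit. Unset Printing Implicit Defensive.
Import Order.TTheory GRing.Theory Num.Theory.
Local Open Scope ring_scope.

(* A neutral matrix with opening row [u], closing row [x = u + 1] and lower 1 of the
   opening column in row [m] is a permutation matrix [p] with a marked pattern
   [p u < p m < p x], in which row [u] has been replaced by the unit vector at [p m]
   and row [x] by [e_(p u) - e_(p m) + e_(p x)].  Writing [l] for the Lehmer code of
   [p] and [r] for the rank of [p m] among the values below row [x], its generalized
   inversion table is [k = n - u], [a_(k-1) = l u], [a_k = r + 1], [b = l x - r - 1],
   [a_(n-i) = l i] on the other rows, and [ell = r - l u].  Since the Lehmer code is a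
   bijection, the tables that occur are exactly those satisfying [is_table].

   On the path side, a configuration with one N-step has one S-step, in the path [k]
   say.  The permutation of the endpoints and the disjointness of the Right parts force
   the N-step to be in the path [k - 1], and disjointness of the Left and Right parts of
   these two paths amounts to the two strict inequalities of [is_table]. *)

(** * Entries, searches and sums in terms of ordinals *)

Lemma iota1_ord n : iota 1 n = [seq (nat_of_ord i).+1 | i <- enum 'I_n].
Proof. by rewrite -[1%N]addn0 iotaDl -val_enum_ord -map_comp. Qed.

Lemma entE n (A : 'M[int]_n) (i j : 'I_n) : ent A i.+1 j.+1 = A i j.
Proof. by rewrite /ent /= !valK. Qed.

Lemma has_iota1 n (P : pred nat) : has P (iota 1 n) = [exists i : 'I_n, P i.+1].
Proof.
rewrite iota1_ord has_map; apply/hasP/existsP => [[i _ Pi]|[i Pi]].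
  by exists i.
by exists i => //; rewrite mem_enum.
Qed.

Lemma all_iota1P n (P : pred nat) :
  reflect (forall i : 'I_n, P i.+1) (all P (iota 1 n)).
Proof.
rewrite iota1_ord all_map; apply: (iffP allP) => h i; last by move=> _; exact: h.
by apply: h; rewrite mem_enum.
Qed.

Lemma first_in_ord n (P : pred nat) (v : 'I_n) :
  P v.+1 -> (forall w : 'I_n, (w < v)%N -> ~~ P w.+1) -> first_in n P = v.+1.
Proof.
move=> Pv ltP; rewrite /first_in iota1_ord find_map; congr _.+1.
have hv : has (preim (fun i : 'I_n => i.+1) P) (enum 'I_n).
  by apply/hasP; exists v => //; rewrite mem_enum.
have lt_f : (find (preim (fun i : 'I_n => i.+1) P) (enum 'I_n) < n)%N.
  by move: hv; rewrite has_find size_enum_ord.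
have := nth_find v hv; rewrite /= (nth_enum_ord v lt_f) => Pf.
apply/eqP; rewrite eqn_leq; apply/andP; split; rewrite leqNgt; apply/negP => lt.
  by have := before_find v lt; rewrite /= nth_enum_ord // Pv.
by have := ltP (Ordinal lt_f) lt; rewrite /= Pf.
Qed.

Lemma first_in_unique n (P : pred nat) (v : 'I_n) :
  (forall w : 'I_n, P w.+1 = (w == v)) -> first_in n P = v.+1.
Proof.
move=> Pv; apply: first_in_ord => [|w lt_wv]; first by rewrite Pv eqxx.
by rewrite Pv -val_eqE neq_ltn lt_wv.
Qed.

(** Passing to 0-based indices shifts the lower bounds but not the strict upper one: rows satisfy
    [r <= i], columns [c1 <= j] and [j.+1 < c2]. The bound on [c2] keeps the columns inside the
    matrix. *)
Lemma sum_below_betweenE n (A : 'M[int]_n) (r c1 c2 : nat) : (c2 <= n.+1)%N ->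
  sum_below_between A r c1 c2 =
  \sum_(i < n | (r <= i)%N) \sum_(j < n | (c1 <= j)%N && (j.+1 < c2)%N) A i j.
Proof.
move=> le_c2; rewrite /sum_below_between -subSS -/(index_iota r.+1 n.+1).
rewrite big_add1 /= big_geq_mkord; apply: eq_bigr => i _.
rewrite -/(index_iota c1.+1 c2); case: c2 le_c2 => [|c2] le_c2.
  by rewrite big_geq // big1 // => j; rewrite andbF.
rewrite big_add1 (big_nat_widen _ _ n) // big_geq_mkord.
by apply: eq_big => [j|j _]; rewrite ?entE //= andbC.
Qed.

(** * Sign sequences *)

(** Peeling off a pair [1, -1] leaves a sequence of the same kind, so sign sequences are handled two
    entries at a time. *)
Lemma alternating_cons2 x y t :
  alternating [:: x, y & t] = [&& x == 1, y == -1 & alternating t].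
Proof.
rewrite /=; case: eqP => //= ->; case: t => [|z t] /=.
  by rewrite andbF; case: eqP => [->|].
case: (eqVneq y (-1)) => [->|/=]; last by rewrite andbF.
by rewrite opprK /=; case: (z == 1); rewrite ?andbF.
Qed.

(** The pairs [1, -1] cancel and the final 1 remains; the induction is on a bound for the size
    because two entries go at once. *)
Lemma alternating_sum s : alternating s -> \sum_(x <- s) x = 1.
Proof.
have [m] := ubnP (size s); elim: m s => // m IH [|x [|y s]] // lt.
  by move=> /andP[/eqP-> _]; rewrite big_seq1.
rewrite alternating_cons2 => /and3P[/eqP-> /eqP-> alt].
by rewrite !big_cons (IH s) //; move: lt => /=; lia.
Qed.

Lemma alternating_count0 s : alternating s -> count_mem (-1) s = 0%N -> s = [:: 1].
Proof.
case: s => [|x [|y s]] //; first by move=> /andP[/eqP->].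
by rewrite alternating_cons2 => /and3P[_ /eqP-> _] /=; lia.
Qed.

Lemma alternating_count1 s :
  alternating s -> count_mem (-1) s = 1%N -> s = [:: 1; -1; 1].
Proof.
case: s => [|x [|y s]] //; first by move=> /andP[/eqP->].
rewrite alternating_cons2 => /and3P[/eqP-> /eqP-> alt] /= [e].
by rewrite (alternating_count0 alt).
Qed.

(** * Rows and columns described by the positions of their nonzero entries *)

Section SignLine.
Variables (n : nat) (f : nat -> int).
Let nz := [seq x <- [seq f c | c <- iota 1 n] | x != 0].
Let supp := [seq c : 'I_n <- enum 'I_n | f c.+1 != 0].

Lemma nz_supp : nz = [seq f (nat_of_ord c).+1 | c <- supp].
Proof. by rewrite /nz /supp iota1_ord -map_comp filter_map. Qed.

Lemma sorted_supp : sorted ltn (map val supp).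
Proof.
rewrite sorted_map; apply: sorted_filter; first by move=> a b c /=; exact: ltn_trans.
by have := iota_ltn_sorted 0 n; rewrite -val_enum_ord sorted_map.
Qed.

Lemma suppE (c : 'I_n) : (c \in supp) = (f c.+1 != 0).
Proof. by rewrite mem_filter mem_enum andbT. Qed.

(** A strictly increasing list is determined by its members, so finding the support reduces to a
    membership test. *)
Lemma supp_sorted_eq (s : seq 'I_n) :
  sorted ltn (map val s) -> s =i supp -> supp = s.
Proof.
move=> ss es; apply: (inj_map val_inj).
apply: (irr_sorted_eq ltn_trans ltnn sorted_supp ss) => c.
by apply/mapP/mapP => -[d d_in ->]; exists d; rewrite // ?es // -es.
Qed.

Lemma sum_nz : \sum_(x <- nz) x = \sum_(c < n) f c.+1.
Proof.
rewrite nz_supp big_map big_filter big_enum_cond /= [RHS](bigID (fun c : 'I_n => f c.+1 != 0)) /=.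
by rewrite [X in _ + X]big1 ?addr0 // => c /negPn/eqP.
Qed.

Lemma count_nz : count_mem (-1) nz = #|[set c : 'I_n | f c.+1 == -1]|.
Proof.
rewrite nz_supp count_map count_filter -sum1_count big_enum_cond sum1dep_card.
by apply: eq_card => c; rewrite !inE /=; case: eqP => //= ->.
Qed.

Lemma nz_one : nz = [:: 1] -> exists p : 'I_n, forall c : 'I_n, f c.+1 = (c == p)%:R.
Proof.
rewrite nz_supp; case e : supp => [|p [|? ?]] //= [fp].
exists p => c; have := suppE c; rewrite e inE.
by case: eqP => [->|_ /esym/negbFE/eqP].
Qed.

Lemma nz_oneI (p : 'I_n) : (forall c : 'I_n, f c.+1 = (c == p)%:R) -> nz = [:: 1].
Proof.
move=> fE; rewrite nz_supp (@supp_sorted_eq [:: p]) //= ?fE ?eqxx //.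
by move=> c; rewrite suppE fE inE; case: eqP.
Qed.

Lemma nz_three : nz = [:: 1; -1; 1] -> exists p q r : 'I_n,
  [/\ (p < q)%N, (q < r)%N &
      forall c : 'I_n, f c.+1 = (c == p)%:R - (c == q)%:R + (c == r)%:R].
Proof.
rewrite nz_supp; have := sorted_supp.
case e : supp => [|p [|q [|r [|? ?]]]] //= /and3P[ltpq ltqr _] [fp fq fr].
exists p, q, r; split=> // c; have := suppE c; rewrite e !inE.
have nqp : (q == p) = false by rewrite -val_eqE /= gtn_eqF.
have nrq : (r == q) = false by rewrite -val_eqE /= gtn_eqF.
have nrp : (r == p) = false by rewrite -val_eqE /= gtn_eqF // (ltn_trans ltpq).
case: (eqVneq c p) => [->|_]; first by rewrite fp ![p == _]eq_sym nqp nrp.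
case: (eqVneq c q) => [->|_]; first by rewrite fq ![q == _]eq_sym nrq.
by case: eqP => [->|_ /esym/negbFE/eqP] //; rewrite fr.
Qed.

Lemma nz_threeI (p q r : 'I_n) : (p < q)%N -> (q < r)%N ->
  (forall c : 'I_n, f c.+1 = (c == p)%:R - (c == q)%:R + (c == r)%:R) ->
  nz = [:: 1; -1; 1].
Proof.
move=> ltpq ltqr fE.
have nqp : (q == p) = false by rewrite -val_eqE /= gtn_eqF.
have nrq : (r == q) = false by rewrite -val_eqE /= gtn_eqF.
have nrp : (r == p) = false by rewrite -val_eqE /= gtn_eqF // (ltn_trans ltpq).
rewrite nz_supp (@supp_sorted_eq [:: p; q; r]) /= ?ltpq ?ltqr //.
  by rewrite !fE !eqxx ![p == _]eq_sym ![q == r]eq_sym nqp nrp nrq.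
move=> c; rewrite suppE fE !inE.
case: (eqVneq c p) => [->|_]; first by rewrite ![p == _]eq_sym nqp nrp.
case: (eqVneq c q) => [->|_]; first by rewrite ![q == _]eq_sym nrq.
by case: eqP.
Qed.

End SignLine.

(** * Neutral matrices as permutations with a marked pattern *)

(* Rows and columns are 0-based from here on: [u] is the opening row, [x] the
   closing row and [m] the row of the lower 1 of the opening column [p m]. *)
Definition neutral_data n (p : {perm 'I_n}) (u x m : 'I_n) : bool :=
  [&& x == u.+1 :> nat, (x < m)%N, (p u < p m)%N & (p m < p x)%N].

Definition asm_of n (p : {perm 'I_n}) (u x m : 'I_n) : 'M[int]_n :=
  \matrix_(i, j) (if i == u then (j == p m)%:R
    else if i == x then (j == p u)%:R - (j == p m)%:R + (j == p x)%:R
    else (j == p i)%:R).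

(** For [m] below [x] this is the 0-based rank of [p m] among the values in the rows below [x]; the
    diagonal case [x = m] is the Lehmer code. *)
Definition rank_below n (p : {perm 'I_n}) (x m : 'I_n) : nat :=
  #|[set j : 'I_n | (x < j)%N && (p j < p m)%N]|.

Definition lehmer n (p : {perm 'I_n}) (i : 'I_n) : nat := rank_below p i i.

(** * The statistics of the matrix attached to a marked permutation *)

Section AsmOf.
Variables (n : nat) (p : {perm 'I_n}) (u x m : 'I_n).
Hypothesis D : neutral_data p u x m.
Let A := asm_of p u x m.

Let xE : x = u.+1 :> nat. Proof. by case/and4P: D => /eqP. Qed.
Let ltxm : (x < m)%N. Proof. by case/and4P: D. Qed.
Let lt_pu_pm : (p u < p m)%N. Proof. by case/and4P: D. Qed.
Let lt_pm_px : (p m < p x)%N. Proof. by case/and4P: D. Qed.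
Let lt_pu_px : (p u < p x)%N. Proof. exact: ltn_trans lt_pm_px. Qed.
Let ltux : (u < x)%N. Proof. by rewrite xE. Qed.
Let xu : (x == u) = false. Proof. by rewrite -val_eqE /= gtn_eqF. Qed.
Let pum : (p u == p m) = false. Proof. by rewrite -val_eqE /= ltn_eqF. Qed.
Let pux : (p u == p x) = false. Proof. by rewrite -val_eqE /= ltn_eqF. Qed.
Let pmx : (p m == p x) = false. Proof. by rewrite -val_eqE /= ltn_eqF. Qed.

(** The matrix is the permutation matrix of [p] plus a rank-one correction, a column vector times a
    row vector. Sums over blocks of rows and columns therefore factor. *)
Lemma asm_ofE i j : A i j =
  (j == p i)%:R + ((i == u)%:R - (i == x)%:R) * ((j == p m)%:R - (j == p u)%:R).
Proof.
rewrite mxE; case: (eqVneq i u) => [->|_].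
  by rewrite [u == x]eq_sym xu subr0 mul1r addrC subrK.
case: (eqVneq i x) => [->|_]; last by rewrite subr0 mul0r addr0.
by rewrite sub0r mulN1r opprB addrC.
Qed.

Lemma asm_of_eqN1 i j : (A i j == -1) = (i == x) && (j == p m).
Proof.
rewrite mxE; case: (eqVneq i u) => [->|_].
  by rewrite [u == x]eq_sym xu; case: (j == p m).
case: (eqVneq i x) => _ /=; last by case: (j == p i).
case: (eqVneq j (p m)) => [->|_]; first by rewrite [p m == p u]eq_sym pum pmx.
by case: (eqVneq j (p u)) => [->|_]; rewrite ?pux //; case: (j == p x).
Qed.

Lemma asm_of_eq1 i j : (A i j == 1) =
  if i == u then j == p m else if i == x then (j == p u) || (j == p x) else j == p i.
Proof.
rewrite mxE; case: (eqVneq i u) => _; first by case: (j == p m).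
case: (eqVneq i x) => _ /=; last by case: (j == p i).
case: (eqVneq j (p m)) => [->|_]; first by rewrite [p m == p u]eq_sym pum pmx.
by case: (eqVneq j (p u)) => [->|_]; rewrite ?pux //; case: (j == p x).
Qed.

Lemma asm_of_in_A1 : in_A1 A.
Proof.
apply/andP; split; [apply/and3P; split|].
- apply/forallP => i; apply/forallP => j; rewrite !inE asm_of_eqN1 asm_of_eq1.
  rewrite mxE; case: (i == u); first by case: (j == p m); rewrite ?orbT.
  case: (i == x); last by case: (j == p i); rewrite ?orbT.
  case: (eqVneq j (p m)) => //= jm.
  by case: (eqVneq j (p u)) => [->|_]; rewrite ?orbT //; case: (j == p x); rewrite ?orbT.
- apply/all_iota1P => i; rewrite /row_nz.
  case: (eqVneq i x) => [->|ix].
    rewrite (@nz_threeI _ _ (p u) (p m) (p x)) // => j.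
    by rewrite entE mxE xu eqxx.
  case: (eqVneq i u) => [->|iu].
    by rewrite (@nz_oneI _ _ (p m)) // => j; rewrite entE mxE eqxx.
  by rewrite (@nz_oneI _ _ (p i)) // => j; rewrite entE mxE (negbTE iu) (negbTE ix).
(* Column [p m] receives all three signs, in rows [u], [x], [m]; in column [p u] the 1 moves from
   row [u] to row [x]; the other columns are those of [p]. *)
- apply/all_iota1P => j; rewrite /col_nz -[j](permKV p); set i0 := (p^-1)%g j.
  case: (eqVneq i0 m) => [->|im].
    rewrite (@nz_threeI _ _ u x m) // => i; rewrite entE asm_ofE eqxx.
    by rewrite [p m == p u]eq_sym pum (inj_eq perm_inj) [m == i]eq_sym subr0 mulr1 addrC.
  case: (eqVneq i0 u) => [->|iu].
    rewrite (@nz_oneI _ _ x) // => i; rewrite entE asm_ofE eqxx pum.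
    by rewrite (inj_eq perm_inj) [u == i]eq_sym sub0r mulrN1 opprB addrC subrK.
  rewrite (@nz_oneI _ _ i0) // => i; rewrite entE asm_ofE !(inj_eq perm_inj).
  by rewrite (negbTE im) (negbTE iu) subrr mulr0 addr0 eq_sym.
- rewrite -(cards1 (x, p m)); apply/eqP; apply: eq_card => -[i j].
  by rewrite !inE asm_of_eqN1.
Qed.

Lemma asm_of_closing_row : closing_row A = x.+1.
Proof.
apply: first_in_unique => i; rewrite has_iota1.
apply/existsP/eqP => [[j]|->]; last by exists (p m); rewrite entE asm_of_eqN1 !eqxx.
by rewrite entE asm_of_eqN1 => /andP[/eqP].
Qed.

Lemma asm_of_opening_col : opening_col A = (p m).+1.
Proof.
apply: first_in_unique => j.
by rewrite asm_of_closing_row entE asm_of_eqN1 eqxx.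
Qed.

Lemma asm_of_opening_row : opening_row A = u.+1.
Proof.
apply: first_in_unique => i; rewrite asm_of_closing_row asm_of_opening_col.
rewrite entE asm_of_eq1 ltnS; case: (eqVneq i u) => [->|iu]; first by rewrite ltux eqxx.
case: (eqVneq i x) => [->|ix]; first by rewrite ltnn.
rewrite (inj_eq perm_inj); case: eqP => [<-|_]; last by rewrite andbF.
by rewrite ltnNge ltnW.
Qed.

Lemma asm_of_closing_col : closing_col A = (p x).+1.
Proof.
apply: first_in_unique => j; rewrite asm_of_closing_row asm_of_opening_col.
rewrite entE asm_of_eq1 xu eqxx ltnS; case: (eqVneq j (p x)) => [->|jx].
  by rewrite lt_pm_px orbT.
by rewrite orbF; case: eqP => [->|_]; rewrite ?andbF // ltnNge ltnW.
Qed.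

Lemma asm_of_neutral : neutral A.
Proof. by rewrite /neutral asm_of_closing_row asm_of_opening_row xE. Qed.

(** The closing row comes right after the opening row and already has a 1, at [p u], in the left
    side. *)
Lemma asm_of_leading_row : leading_row A = x.+1.
Proof.
apply: first_in_ord => [|i lt_ix]; rewrite asm_of_opening_row asm_of_opening_col ltnS.
  rewrite ltux /= has_iota1; apply/existsP; exists (p u).
  by rewrite ltnS lt_pu_pm entE asm_of_eq1 xu !eqxx.
by rewrite ltnNge -ltnS -xE lt_ix.
Qed.

Lemma asm_of_leading_col : leading_col A = (p u).+1.
Proof.
apply: first_in_unique => j; rewrite asm_of_leading_row asm_of_opening_col.
rewrite entE asm_of_eq1 xu eqxx ltnS; case: (eqVneq j (p u)) => [->|ju].
  by rewrite lt_pu_pm.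
by case: eqP => [->|_]; rewrite ?andbF //= ltnNge ltnW.
Qed.

Lemma asm_of_col1 (i : 'I_n) :
  Defs.col1 A i.+1 = (if i == u then p m else if i == x then p u else p i).+1.
Proof.
apply: first_in_ord => [|j]; rewrite entE asm_of_eq1.
  by case: (i == u); case: (i == x); rewrite ?eqxx.
case: (i == u); first by move=> lt; rewrite -val_eqE /= ltn_eqF.
case: (i == x); last by move=> lt; rewrite -val_eqE /= ltn_eqF.
move=> lt; rewrite -!val_eqE /= !ltn_eqF //; exact: ltn_trans lt_pu_px.
Qed.

(** In the rank-one correction, rows [u] and [x] carry opposite weights. They cancel when both are
    summed and vanish when neither is; since [x = u + 1], only [r = x] separates them. *)
Lemma asm_of_sum (r : nat) (J : pred 'I_n) :
  \sum_(i < n | (r <= i)%N) \sum_(j < n | J j) A i j =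
  #|[set i : 'I_n | (r <= i)%N && J (p i)]|%:Z
    + (r == x)%:R * ((J (p u))%:R - (J (p m))%:R).
Proof.
have sumJ q : \sum_(j < n | J j) (j == q)%:R = (J q)%:R :> int.
  rewrite big_mkcond (bigD1 q) //= eqxx big1 => [|j /negbTE->]; last by case: ifP.
  by rewrite addr0; case: (J q).
under eq_bigr => i _.
  under eq_bigr => j _ do rewrite asm_ofE.
  rewrite big_split -mulr_sumr sumrB !sumJ.
  over.
rewrite big_split -mulr_suml sumrB /=; congr (_ + _).
  rewrite -sum1dep_card (big_morph _ PoszD (erefl 0%:Z)) big_mkcondr.
  by apply: eq_bigr => i _; case: (J (p i)).
have sumI q : \sum_(i < n | (r <= i)%N) (i == q)%:R = (r <= q)%N%:R :> int.
  rewrite big_mkcond (bigD1 q) //= eqxx big1 => [|i /negbTE->]; last by case: ifP.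
  by rewrite addr0; case: (_ <= _)%N.
rewrite !sumI xE; case: (ltngtP r u.+1) => [lt|lt|->]; rewrite ?(mul0r, mul1r) ?ltnn.
- by rewrite -ltnS lt subrr mul0r.
- by rewrite leqNgt ltnW // subrr mul0r.
- by rewrite sub0r mulN1r opprB.
Qed.

Lemma asm_of_sum_below_between (r c1 c2 : nat) : (c2 <= n)%N ->
  sum_below_between A r c1 c2.+1 =
  #|[set i : 'I_n | (r <= i)%N && ((c1 <= p i)%N && (p i < c2)%N)]|%:Z
    + (r == x)%:R * (((c1 <= p u)%N && (p u < c2)%N)%:R
                     - ((c1 <= p m)%N && (p m < c2)%N)%:R).
Proof.
move=> le; rewrite sum_below_betweenE //.
exact: (asm_of_sum r (fun j : 'I_n => (c1 <= j)%N && (j.+1 < c2.+1)%N)).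
Qed.

(** The only row below [u] and not below [x] is [x] itself, and [p x] exceeds [p u]. *)
Lemma lehmer_opening :
  lehmer p u = #|[set j : 'I_n | (x < j)%N && (p j < p u)%N]|.
Proof.
apply: eq_card => j; rewrite !inE; case: (eqVneq j x) => [->|].
  by rewrite ltnn [(p x < _)%N]ltnNge (ltnW lt_pu_px) andbF.
by rewrite -val_eqE /= => jx; congr (_ && _); move: jx xE; lia.
Qed.

Lemma lehmer_opening_le : (lehmer p u <= rank_below p x m)%N.
Proof.
rewrite lehmer_opening; apply: subset_leq_card; apply/subsetP => j.
by rewrite !inE => /andP[-> /ltn_trans->].
Qed.

(** Columns [p u] and [p m] bound the leading cell and lie outside it, so the correction vanishes.
    What is left counts the values strictly between [p u] and [p m] in the rows below [x], row [x]
    being excluded by [p x > p m]. *)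
Lemma asm_of_ell : ell A = (rank_below p x m)%:Z - (lehmer p u)%:Z.
Proof.
rewrite /ell asm_of_opening_row asm_of_leading_col asm_of_opening_col.
rewrite (asm_of_sum_below_between _ _ (ltnW (ltn_ord _))).
rewrite !ltnn andbF subrr mulr0 addr0.
suff -> : rank_below p x m = (lehmer p u + #|[set i : 'I_n | (u < i)%N &&
    ((p u < p i)%N && (p i < p m)%N)]|)%N by rewrite PoszD addrC addKr.
rewrite lehmer_opening /rank_below.
rewrite -(cardsID [set j : 'I_n | (p j < p u)%N] [set j : 'I_n | (x < j)%N && _]).
congr (_ + _)%N; apply: eq_card => j; rewrite !inE ?ltnS.
  by move: lt_pu_pm; lia.
case: (eqVneq j x) => [->|]; first by move: lt_pm_px; lia.
case: (eqVneq (p j) (p u)) => [/perm_inj ->|]; first by move: xE; lia.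
by rewrite -!val_eqE /=; move: xE; lia.
Qed.

Lemma asm_of_cval_ge0 : 0 <= cval A.
Proof.
rewrite /cval asm_of_closing_row asm_of_closing_col asm_of_opening_col.
rewrite (asm_of_sum_below_between _ _ (ltnW (ltn_ord _))).
by rewrite [x.+1 == x]gtn_eqF // mul0r addr0.
Qed.

(** Below row [x], the values smaller than [p x] are those smaller than [p m], then [p m] itself,
    then those strictly between [p m] and [p x], which make up the closing cell. *)
Lemma lehmer_closing : (lehmer p x)%:Z = (rank_below p x m)%:Z + 1 + cval A.
Proof.
rewrite /cval asm_of_closing_row asm_of_closing_col asm_of_opening_col.
rewrite (asm_of_sum_below_between _ _ (ltnW (ltn_ord _))).
rewrite [x.+1 == x]gtn_eqF // mul0r addr0 -!PoszD; congr Posz.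
rewrite /lehmer {1}/rank_below (cardsD1 m) inE ltxm lt_pm_px addnAC addn1 add1n.
congr _.+1; rewrite -(cardsID [set j : 'I_n | (p j < p m)%N]).
congr (_ + _)%N; apply: eq_card => j; rewrite !inE ?ltnS.
  case: (eqVneq j m) => [->|_]; first by lia.
  by move: lt_pm_px; lia.
case: (eqVneq j m) => [->|]; first by lia.
by rewrite -(inj_eq (@perm_inj _ p)) -val_eqE /=; lia.
Qed.

(** For [i = u] the sum starts at row [x], where the correction adds 1 because [p u] is left of
    [p m]. For [i = x] the leftmost 1 is in column [p u], and [lehmer_opening] applies. *)
Lemma asm_of_ainv (i : 'I_n) : ainv A (n - i) =
  (if i == u then (rank_below p x m).+1
   else if i == x then lehmer p u else lehmer p i)%:Z.
Proof.
have -> : (ainv A (n - i) = sum_below_between A i.+1 0 (Defs.col1 A i.+1))%R.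
  by rewrite /ainv subSn ?leq_subr // subKn // ltnW.
rewrite asm_of_col1; set c := if i == u then _ else _.
rewrite (asm_of_sum_below_between _ _ (ltnW (ltn_ord _))) /c.
case: (eqVneq i u) => [->|iu].
  rewrite -xE eqxx mul1r !leq0n lt_pu_pm ltnn subr0 -addn1 PoszD; congr (Posz _ + _).
  apply: eq_card => j; rewrite !inE; case: (eqVneq j x) => [->|].
    by move: lt_pm_px; lia.
  by rewrite -val_eqE /=; lia.
have -> : (i.+1 == x) = false by rewrite xE eqSS; exact: negbTE.
rewrite mul0r addr0; case: (eqVneq i x) => [->|ix]; last by [].
by rewrite lehmer_opening.
Qed.

End AsmOf.

(** * Recovering the marked permutation from a neutral matrix *)

Lemma surj_inj_ord n (f : 'I_n -> 'I_n) : (forall c, exists i, f i = c) -> injective f.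
Proof.
move=> surj; suff /image_injP inj : #|image f 'I_n| == #|'I_n|.
  by move=> i j; apply: inj.
apply/eqP; apply: eq_card => c; rewrite inE; have [i <-] := surj c.
by apply/imageP; exists i.
Qed.

Lemma neutral_asm_of n (A : 'M[int]_n) : in_A1 A -> neutral A ->
  exists p u x m, neutral_data p u x m /\ A = asm_of p u x m.
Proof.
case/andP => /and3P[_ /all_iota1P rowA /all_iota1P colA] /cards1P[[x y] setN1] neu.
have AN1 i j : (A i j == -1) = (i == x) && (j == y).
  by have := in_set1 (i, j) (x, y); rewrite -setN1 inE.
have crE : closing_row A = x.+1.
  apply: first_in_unique => i; rewrite has_iota1.
  by apply/existsP/eqP => [[j]|->]; [|exists y]; rewrite entE AN1 ?eqxx // => /andP[/eqP].
have ocE : opening_col A = y.+1.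
  by apply: first_in_unique => j; rewrite crE entE AN1 eqxx.
have [pu [y' [px [lt_pu_y lt_y_px rowx]]]] : exists p q r : 'I_n,
    [/\ (p < q)%N, (q < r)%N &
      forall c : 'I_n, A x c = (c == p)%:R - (c == q)%:R + (c == r)%:R].
  have [|p [q [r [? ? h]]]] := @nz_three n (ent A x.+1).
    apply: alternating_count1; first exact: rowA.
    rewrite count_nz -(cards1 y); apply: eq_card => c.
    by rewrite !inE entE AN1 eqxx.
  by exists p, q, r; split=> // c; rewrite -h entE.
have ey : y' = y.
  apply/eqP; have := AN1 x y'; rewrite eqxx /= => <-; rewrite rowx eqxx.
  by rewrite -!val_eqE /= (gtn_eqF lt_pu_y) (ltn_eqF lt_y_px).
move: lt_pu_y lt_y_px rowx; rewrite {}ey => lt_pu_y lt_y_px rowx.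
have [u [x' [m [ltux ltxm coly]]]] : exists p q r : 'I_n,
    [/\ (p < q)%N, (q < r)%N &
      forall c : 'I_n, A c y = (c == p)%:R - (c == q)%:R + (c == r)%:R].
  have [|p [q [r [? ? h]]]] := @nz_three n (fun r => ent A r y.+1).
    apply: alternating_count1; first exact: colA.
    rewrite count_nz -(cards1 x); apply: eq_card => c.
    by rewrite !inE entE AN1 eqxx andbT.
  by exists p, q, r; split=> // c; rewrite -h entE.
have ex : x' = x.
  apply/eqP; have := AN1 x' y; rewrite eqxx andbT => <-; rewrite coly eqxx.
  by rewrite -!val_eqE /= (gtn_eqF ltux) (ltn_eqF ltxm).
move: ltux ltxm coly; rewrite {}ex => ltux ltxm coly.
have xu : (x == u) = false by rewrite -val_eqE /= gtn_eqF.
have ux : u != x by rewrite eq_sym xu.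
have mx : (m == x) = false by rewrite -val_eqE /= gtn_eqF.
have mu : (m == u) = false by rewrite -val_eqE /= gtn_eqF // (ltn_trans ltux).
have orE : opening_row A = u.+1.
  apply: first_in_unique => i; rewrite crE ocE entE coly ltnS.
  case: (eqVneq i u) => [->|_]; first by rewrite ltux [u == x]eq_sym xu [u == m]eq_sym mu.
  case: (eqVneq i x) => [->|_]; first by rewrite ltnn.
  by case: (eqVneq i m) => [->|_]; rewrite ?andbF // ltnNge ltnW.
have xE : x = u.+1 :> nat.
  by move: neu; rewrite /neutral crE orE => /eqP[].
(* Outside row [x] each row has a single 1 and the search finds it, so the default [y] does not
   matter. *)
pose g i := odflt y [pick c | A i c == 1].
have gE i j : i != x -> A i j = (j == g i)%:R.
  move=> ix; have [|c h] := @nz_one n (ent A i.+1).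
    apply: alternating_count0; first exact: rowA.
    rewrite count_nz; apply/eqP; rewrite cards_eq0; apply/eqP/setP => c.
    by rewrite !inE entE AN1 (negbTE ix).
  have {}h d : A i d = (d == c)%:R by rewrite -h entE.
  rewrite h /g; case: pickP => [d|/(_ c)]; rewrite h ?eqxx //=.
  by case: (eqVneq d c) => [->|].
have gy i : i != x -> A i y = 1 -> g i = y.
  by move=> ix; rewrite gE //; case: (eqVneq y (g i)).
have gu : g u = y.
  by apply: gy; rewrite ?coly ?eqxx ?(negbTE ux) // [u == m]eq_sym mu.
have gm : g m = y.
  by apply: gy; rewrite ?coly mx // mu eqxx.
(* This undoes the modification: the left 1 of the closing row goes to row [u], the right 1 stays in
   row [x]. *)
pose f i := if i == u then pu else if i == x then px else g i.
have AE i j : A i j =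
    (j == f i)%:R + ((i == u)%:R - (i == x)%:R) * ((j == y)%:R - (j == pu)%:R).
  rewrite /f; case: (eqVneq i u) => [->|iu].
    by rewrite gE // gu (negbTE ux) subr0 mul1r addrC subrK.
  case: (eqVneq i x) => [->|ix]; last by rewrite gE // subr0 mul0r addr0.
  by rewrite rowx sub0r mulN1r opprB addrC.
(* A column missed by [f] would only contain entries of the correction, which sum to 0, whereas
   every column of an ASM sums to 1. So [f] is onto, hence injective. *)
have f_inj : injective f.
  apply: surj_inj_ord => c; suff /existsP[i /eqP] : [exists i, f i == c] by exists i.
  apply: contraT; rewrite negb_exists => /forallP no.
  have := alternating_sum (colA c); rewrite sum_nz.
  under eq_bigr => i _ do rewrite entE AE eq_sym (negbTE (no i)) add0r.
  have sum1 q : \sum_(i < n) (i == q)%:R = 1 :> int.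
    by rewrite (bigD1 q) //= eqxx big1 ?addr0 // => i /negbTE->.
  by rewrite -mulr_suml sumrB !sum1 subrr mul0r.
exists (perm f_inj), u, x, m; split.
  rewrite /neutral_data !permE /f xE !eqxx xu mu mx gm -xE ltxm /=.
  by apply/andP.
apply/matrixP => i j; rewrite mxE !permE /f xu mu mx !eqxx gm.
case: (eqVneq i u) => [->|iu]; first by rewrite gE ?gu.
by case: (eqVneq i x) => [->|ix]; [rewrite rowx | rewrite gE].
Qed.

(** * Lehmer codes *)

(** The rank strictly increases with the value: the smaller of two values is counted for the larger
    one but not for itself. *)
Lemma rank_below_inj n (p : {perm 'I_n}) (x m1 m2 : 'I_n) :
  (x < m1)%N -> (x < m2)%N -> rank_below p x m1 = rank_below p x m2 -> m1 = m2.
Proof.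
have lt_rank (y1 y2 : 'I_n) : (x < y1)%N -> (p y1 < p y2)%N ->
    (rank_below p x y1 < rank_below p x y2)%N.
  move=> lt1 lt12; apply: proper_card; rewrite properE; apply/andP; split.
    by apply/subsetP => j; rewrite !inE => /andP[-> /ltn_trans->].
  by apply/negP => /subsetP/(_ y1); rewrite !inE lt1 lt12 ltnn => /(_ isT).
move=> lt1 lt2 e; apply: (@perm_inj _ p); apply: val_inj => /=.
case: (ltngtP (p m1) (p m2)) => // lt.
  by have := lt_rank _ _ lt1 lt; rewrite e ltnn.
by have := lt_rank _ _ lt2 lt; rewrite e ltnn.
Qed.

Lemma card_ord_gt n (x : 'I_n) : #|[set j : 'I_n | (x < j)%N]| = (n - x.+1)%N.
Proof.
rewrite -sum1dep_card; have := big_geq_mkord (op := addn) x.+1 n predT (fun=> 1%N).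
by rewrite sum_nat_const_nat muln1 => ->.
Qed.

(** A discrete intermediate value argument: [g v] goes from 0 to [n - x.+1] in steps of at most 1.
    At the least [v] with [t < g v] there is a jump, so [v - 1] is a value [p m] with [m] below [x],
    and its rank is [t]. *)
Lemma rank_below_surj n (p : {perm 'I_n}) (x : 'I_n) t : (t < n - x.+1)%N ->
  exists2 m : 'I_n, (x < m)%N & rank_below p x m = t.
Proof.
pose g v := #|[set j : 'I_n | (x < j)%N && (p j < v)%N]|.
move=> lt_t; have gn : (t < g n)%N.
  by rewrite /g -card_ord_gt in lt_t *; under eq_finset => j do rewrite ltn_ord andbT.
have ex_v : exists v, (t < g v)%N by exists n.
case: (ex_minnP ex_v) => -[|w] lt_tv min_v.
  by move: lt_tv; rewrite /g; under eq_finset => j do rewrite andbF; rewrite cards0.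
have le_gw : (g w <= t)%N by rewrite leqNgt; apply/negP => /min_v; rewrite ltnn.
have lt_wn : (w < n)%N by apply: min_v.
pose m := (p^-1)%g (Ordinal lt_wn).
have pm : p m = w :> nat by rewrite permKV.
have gS : g w.+1 = ((x < m)%N + g w)%N.
  rewrite /g (cardsD1 m) inE pm ltnSn andbT; congr (_ + _)%N.
  apply: eq_card => j; rewrite !inE; case: (eqVneq j m) => [->|].
    by rewrite pm ltnn andbF.
  by rewrite -(inj_eq (@perm_inj _ p)) -val_eqE /= pm; lia.
exists m; first by move: lt_tv; rewrite gS; case: (x < m)%N => //; lia.
by rewrite /rank_below pm -/(g w); move: lt_tv; rewrite gS; case: (x < m)%N; lia.
Qed.

Lemma lehmer_lt n (p : {perm 'I_n}) (i : 'I_n) : (lehmer p i < n - i)%N.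
Proof.
have : (lehmer p i <= n - i.+1)%N.
  rewrite -card_ord_gt; apply: subset_leq_card.
  by apply/subsetP => j; rewrite !inE => /andP[].
by have := ltn_ord i; lia.
Qed.

Lemma lehmer_values n (p : {perm 'I_n}) (i : 'I_n) :
  lehmer p i = #|[set v : 'I_n | (i <= (p^-1)%g v)%N && (v < p i)%N]|.
Proof.
rewrite -(card_preimset _ (@perm_inj _ p)); apply: eq_card => j.
rewrite !inE permK; case: (eqVneq j i) => [->|]; first by rewrite !ltnn !andbF.
by rewrite -val_eqE /=; lia.
Qed.

(** At the first row where two permutations differ, the same values are still available; the
    permutation with the larger value there has the larger code, since it also counts the other's
    value. *)
Lemma lehmer_inj n (p q : {perm 'I_n}) : lehmer p =1 lehmer q -> p = q.
Proof.
have nlt (p1 p2 : {perm 'I_n}) (i : 'I_n) : lehmer p1 =1 lehmer p2 ->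
    (forall j : 'I_n, (j < i)%N -> p1 j = p2 j) -> ~~ (p1 i < p2 i)%N.
  move=> eL eq_lt; apply/negP => lt12; have := eL i; rewrite !lehmer_values.
  apply/eqP; rewrite neq_ltn; apply/orP; left; apply: proper_card.
  have sub v : (i <= (p1^-1)%g v)%N -> (i <= (p2^-1)%g v)%N.
    rewrite leqNgt => nlt; rewrite leqNgt; apply: contra nlt => lt.
    by rewrite -{1}(permKV p2 v) -eq_lt // permK.
  rewrite properE; apply/andP; split.
    by apply/subsetP => v; rewrite !inE => /andP[/sub-> /ltn_trans->].
  apply/negP => /subsetP/(_ (p1 i)); rewrite !inE ltnn andbF lt12 andbT.
  by move/(_ (sub _ _)); rewrite permK leqnn => /(_ isT).
move=> eL; apply/permP => i; have [k] := ubnP (nat_of_ord i).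
elim: k i => // k IH i lt; have eq_lt (j : 'I_n) : (j < i)%N -> p j = q j.
  by move=> lt_ji; apply: IH; apply: leq_trans lt_ji _.
apply: val_inj => /=; case: (ltngtP (p i) (q i)) => // h.
  by have := nlt p q i eL eq_lt; rewrite h.
by have := nlt q p i (fsym eL) (fun j lt => esym (eq_lt j lt)); rewrite h.
Qed.

(** By counting: the Lehmer map is injective, and there are [n!] permutations and equally many
    admissible codes. *)
Lemma lehmer_surj n (c : 'I_n -> nat) : (forall i : 'I_n, (c i < n - i)%N) ->
  exists p : {perm 'I_n}, lehmer p =1 c.
Proof.
move=> ltc; have ltn_of (v : nat) (i : 'I_n) : (v < n - i)%N -> (v < n)%N by lia.
pose L (p : {perm 'I_n}) : {ffun 'I_n -> 'I_n} :=
  [ffun i => Ordinal (ltn_of _ _ (lehmer_lt p i))].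
pose F (i : 'I_n) := [pred v : 'I_n | (v < n - i)%N].
have L_inj : injective L.
  by move=> p q eL; apply: lehmer_inj => i; have /ffunP/(_ i) := eL; rewrite !ffunE => -[].
have subF : codom L \subset family F.
  apply/subsetP => _ /codomP[p ->]; apply/familyP => i.
  by rewrite ffunE inE /= lehmer_lt.
have cardF : #|codom L| = #|family F|.
  rewrite card_codom // card_Sn card_family foldrE big_map big_enum /=.
  rewrite -ffactnn ffact_prod; apply: eq_bigr => i _.
  by rewrite -sum1_card (big_ord_narrow (leq_subr i n)) sum1_card card_ord.
have := subset_cardP cardF subF (finfun (fun i => Ordinal (ltn_of _ _ (ltc i)))).
have -> : [ffun i => Ordinal (ltn_of _ _ (ltc i))] \in family F.
  by apply/familyP => i; rewrite ffunE inE /= ltc.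
by move=> /codomP[p /ffunP eL]; exists p => i; have := eL i; rewrite !ffunE => -[].
Qed.

(** * Mixed paths *)

Definition isE (s : step) : bool := if s is sE then true else false.
Definition isS (s : step) : bool := if s is sS then true else false.

Lemma all_lpart w : all isLeft (lpart w).
Proof.
rewrite /lpart; elim: w => //= s w IH.
by case: (boolP (isLeft s)) => h //=; rewrite h.
Qed.

Lemma lpart_rpart w : lpart w ++ rpart w = w.
Proof. exact: cat_take_drop. Qed.

Lemma find_left L R : all isLeft L -> all (fun s => ~~ isLeft s) R ->
  find (fun s => ~~ isLeft s) (L ++ R) = size L.
Proof.
elim: L => [_|s L IH /= /andP[-> allL] allR]; last by rewrite IH.
by case: R => //= s R /andP[->].
Qed.

Lemma lpart_cat L R : all isLeft L -> all (fun s => ~~ isLeft s) R -> lpart (L ++ R) = L.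
Proof. by move=> allL allR; rewrite /lpart find_left // take_size_cat. Qed.

Lemma rpart_cat L R : all isLeft L -> all (fun s => ~~ isLeft s) R -> rpart (L ++ R) = R.
Proof. by move=> allL allR; rewrite /rpart find_left // drop_size_cat. Qed.

Lemma left_word0 L : all isLeft L -> count isS L = 0%N -> L = nseq (size L) sE.
Proof. by elim: L => // -[] //= L IH allL c0; rewrite -IH. Qed.

Lemma left_word1 L : all isLeft L -> count isS L = 1%N ->
  exists a b, L = nseq a sE ++ sS :: nseq b sE.
Proof.
elim: L => // -[] //= L IH allL c1.
  by have [a [b ->]] := IH allL c1; exists a.+1, b.
by exists 0%N, (size L); rewrite -left_word0 //; case: c1.
Qed.

Lemma right_word0 R : all (fun s => ~~ isLeft s) R -> count isN R = 0%N ->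
  R = nseq (size R) sF.
Proof. by elim: R => // -[] //= R IH allR c0; rewrite -IH. Qed.

Lemma right_word1 R : all (fun s => ~~ isLeft s) R -> count isN R = 1%N ->
  exists c d, R = nseq c sF ++ sN :: nseq d sF.
Proof.
elim: R => // -[] //= R IH allR c1.
  by have [c [d ->]] := IH allR c1; exists c.+1, d.
by exists 0%N, (size R); rewrite -right_word0 //; case: c1.
Qed.

Lemma count_isS_rpart w : all (fun s => ~~ isLeft s) (rpart w) ->
  count isS w = count isS (lpart w).
Proof.
move=> allR; rewrite -{1}(lpart_rpart w) count_cat -[RHS]addn0; congr (_ + _)%N.
by elim: (rpart w) allR => // -[].
Qed.

Lemma count_isN_lpart w : count isN w = count isN (rpart w).
Proof.
rewrite -{1}(lpart_rpart w) count_cat -[RHS]add0n; congr (_ + _)%N.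
by elim: (lpart w) (all_lpart w) => // -[].
Qed.

Lemma endpE p w :
  endp p w = (p.1 + (count (predC isS) w)%:Z,
              p.2 + (count isN w)%:Z - (count isS w)%:Z).
Proof.
rewrite /endp; elim: w p => [|s w IH] [x y] /=; first by congr (_, _); lia.
by rewrite IH; case: s => /=; congr (_, _); lia.
Qed.

Lemma endp_cat p w1 w2 : endp p (w1 ++ w2) = endp (endp p w1) w2.
Proof. exact: foldl_cat. Qed.

Lemma mem_verts_cons v p s w :
  (v \in verts p (s :: w)) = (v == p) || (v \in verts (move p s) w).
Proof. by rewrite /verts /= inE. Qed.

Lemma start_in_verts p w : p \in verts p w.
Proof. exact: mem_head. Qed.

Lemma mem_verts_cat v p w1 w2 :
  (v \in verts p (w1 ++ w2)) = (v \in verts p w1) || (v \in verts (endp p w1) w2).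
Proof.
elim: w1 p => [|s w1 IH] p; last by rewrite cat_cons !mem_verts_cons IH orbA.
have -> : (v \in verts p [::]) = (v == p) by rewrite /verts inE.
by case: (eqVneq v p) => [->|] //=; rewrite start_in_verts.
Qed.

Lemma verts_lr p w v :
  (v \in verts p w) = (v \in lverts p w) || (v \in rverts p w).
Proof. by rewrite -{1}(lpart_rpart w) mem_verts_cat. Qed.

Lemma mem_verts_nseq v p a s : s = sE \/ s = sF ->
  (v \in verts p (nseq a s)) = (v.2 == p.2) && (p.1 <= v.1 <= p.1 + a%:Z).
Proof.
move=> hs; have {hs} moveE q : move q s = (q.1 + 1, q.2) by case: hs => ->.
case: v => vx vy; elim: a p => [|a IH] [x y] /=.
  by rewrite /verts /= inE xpair_eqE /=; lia.
by rewrite mem_verts_cons IH moveE xpair_eqE /=; lia.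
Qed.

(** * Configurations attached to inversion tables *)

(** For the paths, [a k.-1 < a k] separates the Left parts of paths [k - 1] and [k], the last
    inequality separates their Right parts, and [a k + b < k.-1] keeps path [k] in the domain after
    its S-step. *)
Definition is_table (n k : nat) (a : nat -> nat) (b beta : nat) : Prop :=
  [/\ (k <= n)%N, forall i, (0 < i <= n)%N -> (a i < i)%N,
      (a k.-1 < a k)%N, (a k + b < k.-1)%N & (a k.-1 + beta < a k + b)%N].

Definition table_left (k : nat) (a : nat -> nat) (b i : nat) : seq step :=
  if i == k then nseq (a i) sE ++ sS :: nseq b sE else nseq (a i) sE.

Definition table_right (k : nat) (a : nat -> nat) (b beta i : nat) : seq step :=
  if i == k.-1 then nseq beta sF ++ sN :: nseq (k.-2 - a i - beta) sF
  else if i == k then nseq (k.-2 - a i - b) sF else nseq (i.-1 - a i) sF.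

Definition table_word k a b beta i := table_left k a b i ++ table_right k a b beta i.

Definition table_config n k a b beta := [seq table_word k a b beta i | i <- iota 1 n].

Lemma nth_table_config n k a b beta (i : 'I_n) :
  nth [::] (table_config n k a b beta) i = table_word k a b beta i.+1.
Proof. by rewrite (nth_map 0%N) ?size_iota // nth_iota // add1n. Qed.

Lemma all_table_left k a b i : all isLeft (table_left k a b i).
Proof. by rewrite /table_left; case: ifP => _; rewrite ?all_cat /= !all_nseq ?orbT. Qed.

Lemma all_table_right k a b beta i :
  all (fun s => ~~ isLeft s) (table_right k a b beta i).
Proof.
rewrite /table_right; case: ifP => _; first by rewrite all_cat /= !all_nseq !orbT.
by case: ifP => _; rewrite all_nseq orbT.
Qed.

Lemma lpart_table k a b beta i : lpart (table_word k a b beta i) = table_left k a b i.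
Proof. exact: lpart_cat (all_table_left _ _ _ _) (all_table_right _ _ _ _ _). Qed.

Lemma rpart_table k a b beta i : rpart (table_word k a b beta i) = table_right k a b beta i.
Proof. exact: rpart_cat (all_table_left _ _ _ _) (all_table_right _ _ _ _ _). Qed.

Lemma junction_table k a b beta i : junction (start i) (table_word k a b beta i) =
  if i == k then ((a k + b)%N%:Z, k%:Z - 1) else ((a i)%:Z, i%:Z).
Proof.
rewrite /junction lpart_table endpE /table_left /start.
by case: eqP => [->|_]; rewrite ?count_cat /= !count_nseq /=; congr (_, _); lia.
Qed.

Lemma mem_lverts_table k a b beta i v : (v \in lverts (start i) (table_word k a b beta i)) =
  if i == k then (v.2 == k%:Z) && (0 <= v.1 <= (a k)%:Z) ||
                 (v.2 == k%:Z - 1) && ((a k)%:Z <= v.1 <= (a k + b)%N%:Z)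
  else (v.2 == i%:Z) && (0 <= v.1 <= (a i)%:Z).
Proof.
rewrite /lverts lpart_table /table_left /start.
case: (eqVneq i k) => [->|_]; last by rewrite mem_verts_nseq /=; [lia|left].
rewrite mem_verts_cat mem_verts_cons endpE !mem_verts_nseq /=; try by left.
by case: v => vx vy; rewrite xpair_eqE !count_nseq /=; lia.
Qed.

Section TableConfig.
Variables (n k : nat) (a : nat -> nat) (b beta : nat).
Hypothesis T : is_table n k a b beta.

Lemma mem_rverts_table i v : (0 < i <= n)%N ->
  (v \in rverts (start i) (table_word k a b beta i)) =
  if i == k.-1 then
    (v.2 == k%:Z - 1) && ((a i)%:Z <= v.1 <= (a i + beta)%N%:Z) ||
    (v.2 == k%:Z) && ((a i + beta)%N%:Z + 1 <= v.1 <= k%:Z - 1)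
  else if i == k then (v.2 == k%:Z - 1) && ((a k + b)%N%:Z <= v.1 <= k%:Z - 2)
  else (v.2 == i%:Z) && ((a i)%:Z <= v.1 <= i%:Z - 1).
Proof.
case: T => [lekn alt ltak ltakb ltbeta] i_n; have ai := alt i i_n.
rewrite /rverts rpart_table junction_table /table_right.
case: (eqVneq i k.-1) => [ei|nik1].
  have -> : (i == k) = false by lia.
  rewrite mem_verts_cat mem_verts_cons endpE !mem_verts_nseq /=; try by right.
  by case: v => vx vy; rewrite -ei in ltak ltbeta *; rewrite xpair_eqE !count_nseq /=; lia.
case: (eqVneq i k) => [ei|nik]; rewrite mem_verts_nseq /=; try by right.
  by rewrite ei; lia.
by lia.
Qed.

Lemma endp_table i : (0 < i <= n)%N -> endp (start i) (table_word k a b beta i) =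
  if i == k.-1 then (k%:Z - 1, k%:Z) else if i == k then (k%:Z - 2, k%:Z - 1)
  else (i%:Z - 1, i%:Z).
Proof.
case: T => [lekn alt ltak ltakb ltbeta] i_n; have ai := alt i i_n.
rewrite /table_word endp_cat -{1}(lpart_table k a b beta) -/(junction _ _).
rewrite junction_table endpE /table_right.
case: (eqVneq i k.-1) => [ei|nik1].
  have -> : (i == k) = false by lia.
  rewrite -ei in ltak ltbeta *.
  by rewrite ?count_cat /= ?count_nseq /=; congr (_, _); lia.
case: (eqVneq i k) => [->|_]; rewrite !count_nseq /=; congr (_, _); lia.
Qed.

Lemma count_isN_table i : (0 < i <= n)%N ->
  count isN (table_word k a b beta i) = (i == k.-1).
Proof.
case: T => [lekn alt ltak ltakb ltbeta] i_n.
rewrite count_isN_lpart rpart_table /table_right.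
by case: eqP => _; [|case: eqP => _]; rewrite ?count_cat /= ?count_nseq.
Qed.

Lemma table_config_in_M : in_M n 1 (table_config n k a b beta).
Proof.
have [lekn alt ltak ltakb ltbeta] := T.
have ord_n (i : 'I_n) : (0 < i.+1 <= n)%N by rewrite ltn_ord.
split; [split|].
- by rewrite size_map size_iota.
- move=> i; rewrite nth_table_config; apply/andP; split.
    by rewrite rpart_table all_table_right.
  apply/allP => -[vx vy]; rewrite verts_lr mem_lverts_table mem_rverts_table // /inG /=.
  have := alt _ (ord_n i); have := ltn_ord i.
  case: (eqVneq i.+1 k.-1) => [ei|_].
    have -> : (i.+1 == k) = false by lia.
    by rewrite ei in ltak ltbeta *; lia.
  by case: (eqVneq i.+1 k) => [ei|_]; rewrite ?ei; lia.
- have lt1 : (k.-1 < n)%N by lia.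
  have lt2 : (k.-2 < n)%N by lia.
  (* Only paths [k] and [k - 1], at 0-based positions [k.-1] and [k.-2], exchange their final
     heights. *)
  exists (tperm (Ordinal lt1) (Ordinal lt2)) => i.
  rewrite nth_table_config endp_table //.
  case: tpermP => [->|->|/eqP + /eqP]; rewrite -?val_eqE /=.
  + have -> : (k.-1.+1 == k.-1) = false by lia.
    by have -> : (k.-1.+1 == k) by [lia]; congr (_, _); lia.
  + by have -> : (k.-2.+1 == k.-1) by [lia]; congr (_, _); lia.
  + move=> h1 h2; have -> : (i.+1 == k.-1) = false by lia.
    by have -> : (i.+1 == k) = false by [lia]; congr (_, _); lia.
- move=> i j ij; have {}ij : i != j :> nat by []; apply/hasPn => -[vx vy].
  rewrite !nth_table_config !mem_lverts_table /=.
  case: (eqVneq i.+1 k) => [ei|ni]; case: (eqVneq j.+1 k) => [ej|nj]; try by lia.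
    by case: (eqVneq j.+1 k.-1) => [ej|]; rewrite ?ej; lia.
  by case: (eqVneq i.+1 k.-1) => [ei|]; rewrite ?ei; lia.
- move=> i j ij; have {}ij : i != j :> nat by []; apply/hasPn => -[vx vy].
  rewrite !nth_table_config !mem_rverts_table //=.
  case: (eqVneq i.+1 k.-1) => [ei|ni]; case: (eqVneq j.+1 k.-1) => [ej|nj]; rewrite ?ei ?ej.
  + by lia.
  + by case: (eqVneq j.+1 k) => [ej|]; lia.
  + by case: (eqVneq i.+1 k) => [ei|]; lia.
  + by case: (eqVneq j.+1 k) => [ej|]; case: (eqVneq i.+1 k) => [ei|]; lia.
- rewrite /num_N /table_config -map_comp.
  have -> : [seq (count isN \o table_word k a b beta) i | i <- iota 1 n] =
            [seq nat_of_bool (pred1 k.-1 i) | i <- iota 1 n].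
    by apply/eq_in_map => i; rewrite mem_iota => i_n; rewrite /= count_isN_table //; lia.
  by rewrite sumn_count count_uniq_mem ?iota_uniq // mem_iota; lia.
Qed.

End TableConfig.

(** * From configurations with one N-step back to tables *)

Lemma sum_nat1_delta n (c : 'I_n -> nat) : (\sum_(i < n) c i = 1)%N ->
  exists j, forall i, c i = (i == j).
Proof.
move=> sum1; have [j cj] : exists j, c j != 0%N.
  apply/existsP; apply: contraT; rewrite negb_exists => /forallP no.
  by move: sum1; rewrite big1 // => i _; apply/eqP; have := no i; rewrite negbK.
exists j; move: sum1; rewrite (bigD1 j) //=.
set S := (X in (_ + X)%N) => sum1; have /eqP : S = 0%N by lia.
rewrite sum_nat_eq0 => /forallP no i; case: (eqVneq i j) => [->|ij]; first by lia.
by have := no i; rewrite ij => /eqP.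
Qed.

(** Reads [a i] off a path as the length of its initial run of E-steps; in path [k] the S-step ends
    this run. *)
Lemma find_nseq_E a w : (if w is s :: _ then ~~ isE s else true) ->
  find (fun s => ~~ isE s) (nseq a sE ++ w) = a.
Proof.
move=> hw; elim: a => [|a /= -> //]; case: w hw => //= s w.
by case: (isE s).
Qed.

Section MixedConfig.
Variables (n : nat) (ws : seq (seq step)).
Hypothesis M : in_M n 1 ws.
Let w (i : nat) := nth [::] ws i.

Let size_ws : size ws = n. Proof. by case: M => -[]. Qed.

Let right_w (i : 'I_n) : all (fun s => ~~ isLeft s) (rpart (w i)).
Proof. by case: M => -[_ /(_ i)/andP[]]. Qed.

Let inG_w (i : 'I_n) v : v \in verts (start i.+1) (w i) -> inG n v.
Proof. by case: M => -[_ /(_ i)/andP[_ /allP h] _ _ _ _]; apply: h. Qed.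

Let disjoint_left (i j : 'I_n) v : i != j :> nat ->
  v \in verts (start i.+1) (lpart (w i)) ->
  v \in verts (start j.+1) (lpart (w j)) -> False.
Proof.
by case: M => -[_ _ _ /(_ i j) h _] _ ij vi vj; have /hasPn/(_ v vi) := h ij; rewrite vj.
Qed.

Let disjoint_right (i j : 'I_n) v : i != j :> nat ->
  v \in verts (junction (start i.+1) (w i)) (rpart (w i)) ->
  v \in verts (junction (start j.+1) (w j)) (rpart (w j)) -> False.
Proof.
by case: M => -[_ _ _ _ /(_ i j) h] _ ij vi vj; have /hasPn/(_ v vi) := h ij; rewrite vj.
Qed.

(* Summing the height differences over all paths shows that a configuration has
   as many S-steps as N-steps. *)
Lemma in_M_steps : exists (sigma : {perm 'I_n}) (k j : 'I_n),
  [/\ forall i : 'I_n, count isS (w i) = (i == k),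
      forall i : 'I_n, count isN (w i) = (i == j) &
      forall i : 'I_n, (count (predC isS) (w i) = sigma i /\
                 sigma i + (i == k) = i + (i == j))%N].
Proof.
have [[_ _ [sigma endE] _ _] numN] := M.
have sumN : (\sum_(i < n) count isN (w i) = 1)%N.
  by rewrite -numN /num_N sumnE big_map (big_nth [::]) big_mkord size_ws.
have endi (i : 'I_n) : count (predC isS) (w i) = sigma i /\
    (sigma i + count isS (w i) = i + count isN (w i))%N.
  have := endE i; rewrite endpE -/(w i) /start /= => -[].
  by move: (count _ _) (count isN _) (count isS _) => c1 c2 c3; lia.
have sumS : (\sum_(i < n) count isS (w i) = 1)%N.
  have : (\sum_(i < n) (sigma i + count isS (w i)) =
          \sum_(i < n) (i + count isN (w i)))%N.
    by apply: eq_bigr => i _; case: (endi i).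
  have e : (\sum_(i < n) i = \sum_(i < n) sigma i)%N.
    by rewrite (reindex_inj (@perm_inj _ sigma)).
  by rewrite !big_split /= sumN e => /addnI.
have [k kE] := sum_nat1_delta sumS; have [j jE] := sum_nat1_delta sumN.
by exists sigma, k, j; split=> // i; have := endi i; rewrite kE jE.
Qed.

Lemma in_M_table : exists k a b beta,
  is_table n k a b beta /\ ws = table_config n k a b beta.
Proof.
have [sigma [k0 [j0 [countS countN endi]]]] := in_M_steps.
have left0 (i : 'I_n) : i != k0 -> lpart (w i) = nseq (size (lpart (w i))) sE.
  move=> ik; apply: left_word0; first exact: all_lpart.
  by rewrite -count_isS_rpart // countS (negbTE ik).
have right0 (i : 'I_n) : i != j0 -> rpart (w i) = nseq (size (rpart (w i))) sF.
  move=> ij; apply: right_word0 => //.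
  by rewrite -count_isN_lpart countN (negbTE ij).
have plain (i : 'I_n) : i != k0 -> i != j0 ->
    exists2 a, (a <= i)%N & lpart (w i) = nseq a sE /\ rpart (w i) = nseq (i - a) sF.
  move=> ik ij; have := left0 i ik; have := right0 i ij.
  move: (size (rpart _)) (size (lpart _)) => f a eR eL.
  have e : count (predC isS) (w i) = (a + f)%N.
    by rewrite -(lpart_rpart (w i)) eL eR count_cat !count_nseq /=; lia.
  have [] := endi i; rewrite e (negbTE ik) (negbTE ij) => <- ?; exists a; first by lia.
  by split=> //; rewrite eR; congr nseq; lia.
have [|a [b eLk]] := left_word1 (all_lpart (w k0)).
  by rewrite -count_isS_rpart // countS eqxx.
have [|c [d eRj]] := right_word1 (right_w j0).
  by rewrite -count_isN_lpart countN eqxx.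
(* The path at position [k0] starts at height [k0 + 1], so after its S-step it runs at height
   [k0]. *)
have Lk x : (a%:Z <= x <= (a + b)%N%:Z) ->
    (x, k0%:Z) \in verts (start k0.+1) (lpart (w k0)).
  rewrite eLk mem_verts_cat mem_verts_cons endpE !mem_verts_nseq; try by left.
  by rewrite /start /= xpair_eqE /= !count_nseq /=; lia.
have Gk x : (a%:Z <= x <= (a + b)%N%:Z) -> x < k0%:Z.
  move=> hx; have := inG_w (i := k0) (v := (x, k0%:Z)).
  by rewrite verts_lr /lverts Lk // /inG /= => /(_ isT)/and3P[].
have juk : junction (start k0.+1) (w k0) = ((a + b)%N%:Z, k0%:Z).
  rewrite /junction eLk endpE /start !count_cat /= !count_nseq /=.
  by congr (_, _); lia.
have Rk : ((a + b)%N%:Z, k0%:Z) \in verts (junction (start k0.+1) (w k0)) (rpart (w k0)).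
  by rewrite juk start_in_verts.
have k0_gt : (a + b < k0)%N by have := Gk (a + b)%N%:Z; lia.
have ltk : (k0.-1 < n)%N by have := ltn_ord k0; lia.
(* The position of the preceding path, which starts at height [k0]; it exists because
   [a + b < k0]. *)
pose i' := Ordinal ltk.
have i'k : k0 != i' :> nat by rewrite /=; lia.
have si' : start i'.+1 = (0, k0%:Z) by rewrite /start /=; congr (_, _); lia.
(* Otherwise the Left part of [i'] would reach the point [(a, k0)], where the other path lands after
   its S-step. *)
have a'_lt a' : lpart (w i') = nseq a' sE -> (a' < a)%N.
  move=> eL; rewrite ltnNge; apply/negP => le.
  apply: (@disjoint_left k0 i' (a%:Z, k0%:Z) i'k); first by apply: Lk; lia.
  by rewrite eL si' mem_verts_nseq /=; [lia|left].
have ju' a' : lpart (w i') = nseq a' sE -> junction (start i'.+1) (w i') = (a'%:Z, k0%:Z).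
  move=> eL; rewrite /junction eL endpE si' !count_nseq /=.
  by congr (_, _); lia.
(* If one path had both special steps, path [i'] would stay at height [k0] up to abscissa [k0 - 1],
   and its Right part would meet the junction [(a + b, k0)]. *)
have jk : j0 != k0.
  apply/eqP => jk; have [] := plain i'; rewrite ?jk -?val_eqE /=; try by lia.
  move=> a' le_a' [eL eR]; have lta := a'_lt _ eL.
  apply: (disjoint_right i'k Rk).
  by rewrite (ju' _ eL) eR mem_verts_nseq /=; [lia|right].
(* The N-step makes path [j0] end one position higher. The path at position [j0 + 1] must leave that
   endpoint free, so it has the S-step. *)
have ji : j0 = i'.
  have [_] := endi j0; rewrite eqxx (negbTE jk) => sj.
  have lt_j : (j0.+1 < n)%N by have := ltn_ord (sigma j0); lia.
  case: (eqVneq (Ordinal lt_j) k0) => [e|ne].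
    by apply: val_inj; rewrite /= -e.
  have [_] := endi (Ordinal lt_j); rewrite (negbTE ne) -val_eqE /= => sj1.
  have /perm_inj/(congr1 val)/= : sigma (Ordinal lt_j) = sigma j0.
    by apply: val_inj => /=; lia.
  by lia.
move: eRj; rewrite ji => eR'.
have i'k0 : i' != k0 by rewrite eq_sym.
have eL' := left0 _ i'k0; move: (size (lpart (w i'))) eL' => a' eL'.
have lta := a'_lt _ eL'.
have eRk : rpart (w k0) = nseq (size (rpart (w k0))) sF by apply: right0; rewrite eq_sym.
move: (size (rpart (w k0))) eRk => f eRk.
have d_eq : d = (k0.-1 - a' - c)%N.
  have e : count (predC isS) (w i') = (a' + c + d).+1.
    by rewrite -(lpart_rpart (w i')) eL' eR' !count_cat /= !count_nseq /=; lia.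
  have [] := endi i'; rewrite e (negbTE i'k0) ji eqxx => <- /=; lia.
have f_eq : f = (k0.-1 - a - b)%N.
  have e : count (predC isS) (w k0) = (a + b + f)%N.
    by rewrite -(lpart_rpart (w k0)) eLk eRk !count_cat /= !count_nseq /=; lia.
  have [] := endi k0; rewrite e eqxx eq_sym (negbTE jk) => <-; lia.
(* Otherwise the F-steps preceding the N-step would pass through the junction [(a + b, k0)]. *)
have ltc : (a' + c < a + b)%N.
  rewrite ltnNge; apply/negP => le; apply: (disjoint_right i'k Rk).
  rewrite (ju' _ eL') eR' mem_verts_cat mem_verts_nseq; last by right.
  by rewrite /= eqxx /=; apply/orP; left; lia.
pose A i := find (fun s => ~~ isE s) (w i.-1).
have Ak : A k0.+1 = a.
  by rewrite /A /= -(lpart_rpart (w k0)) eLk -catA find_nseq_E.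
have Ai' : A k0 = a'.
  rewrite /A -[k0.-1]/(nat_of_ord i') -(lpart_rpart (w i')) eL' eR' find_nseq_E //.
  by case: (c).
have Aplain (i : 'I_n) : i != k0 -> i != i' ->
    (A i.+1 <= i)%N /\ w i = nseq (A i.+1) sE ++ nseq (i - A i.+1) sF.
  move=> ik ii; have [|ai le_ai [eL eR]] := plain i ik; first by rewrite ji.
  suff -> : A i.+1 = ai by rewrite -eL -eR lpart_rpart.
  by rewrite /A /= -(lpart_rpart (w i)) eL eR find_nseq_E //; case: (i - ai)%N.
exists k0.+1, A, b, c; split.
  split=> /=; rewrite ?Ak ?Ai' // => -[//|i] lt_in.
  pose io := Ordinal lt_in.
  case: (eqVneq io k0) => [/(congr1 val) /= ->|ik]; first by rewrite Ak; lia.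
  case: (eqVneq io i') => [/(congr1 val) /= ->|ii].
    by rewrite prednK ?Ai'; lia.
  by have [] := Aplain io ik ii.
apply: (@eq_from_nth _ [::]) => [|i]; first by rewrite size_map size_iota.
rewrite size_ws => lt_in; pose io := Ordinal lt_in.
rewrite (nth_table_config _ _ _ _ io) -/(w i) /table_word /table_left /table_right.
case: (eqVneq io k0) => [/(congr1 val) /= ->|ik].
  have -> : (k0.+1 == k0) = false by lia.
  by rewrite eqxx Ak -eLk -f_eq -eRk lpart_rpart.
case: (eqVneq io i') => [/(congr1 val) /= ->|ii].
  rewrite prednK; last by lia.
  have -> : (k0 == k0.+1 :> nat) = false by lia.
  by rewrite eqxx Ai' -d_eq -eL' -eR' lpart_rpart.
have [_ ->] := Aplain io ik ii; move: ik ii; rewrite -!val_eqE /= => ik ii.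
have -> : (i.+1 == k0.+1) = false by lia.
by have -> : (i.+1 == k0) = false by lia.
Qed.
End MixedConfig.

(** Each parameter is read off the words: [k] from the path with the N-step, [a i] from the initial
    run of E-steps, [b] from the length of the Left part of path [k], [beta] from the place of the
    N-step in its Right part. *)
Lemma table_config_inj n k1 a1 b1 beta1 k2 a2 b2 beta2 :
  is_table n k1 a1 b1 beta1 -> is_table n k2 a2 b2 beta2 ->
  table_config n k1 a1 b1 beta1 = table_config n k2 a2 b2 beta2 ->
  [/\ k1 = k2, forall i, (0 < i <= n)%N -> a1 i = a2 i, b1 = b2 & beta1 = beta2].
Proof.
move=> T1 T2 e.
have eW i : (0 < i <= n)%N -> table_word k1 a1 b1 beta1 i = table_word k2 a2 b2 beta2 i.
  by case: i => // i lt; have := congr1 (nth [::] ^~ i) e;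
    rewrite !(nth_table_config _ _ _ _ (Ordinal lt)).
have ek : k1 = k2.
  have [? ? ? ? ?] := T1; have [? ? ? ? ?] := T2.
  have k1n : (0 < k1.-1 <= n)%N by lia.
  have := congr1 (count isN) (eW _ k1n).
  by rewrite (count_isN_table T1) // (count_isN_table T2) // eqxx; lia.
have find_a k a b beta i : find (fun s => ~~ isE s) (table_word k a b beta i) = a i.
  rewrite /table_word /table_left; case: eqP => _; first by rewrite -catA find_nseq_E.
  rewrite find_nseq_E // /table_right; case: eqP => _; first by case: (beta).
  by case: eqP => _; [case: (_ - b)%N|case: (_ - _)%N].
have ea i : (0 < i <= n)%N -> a1 i = a2 i.
  by move=> i_n; have := congr1 (find (fun s => ~~ isE s)) (eW i i_n); rewrite !find_a.
have [? ? ? ? ?] := T1; have kn : (0 < k1 <= n)%N by lia.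
have k1n : (0 < k1.-1 <= n)%N by lia.
split=> //.
  have := congr1 (size \o lpart) (eW _ kn); rewrite /= !lpart_table /table_left -ek eqxx.
  by rewrite ea // !size_cat /= !size_nseq; lia.
have := congr1 (find isN \o rpart) (eW _ k1n).
have findF c w : find isN (nseq c sF ++ sN :: w) = c by elim: c => //= c ->.
by rewrite /= !rpart_table /table_right -ek eqxx !findF.
Qed.

(** * The map [Phi] *)

(** The inequalities of [is_table] make all integer exponents nonnegative, so [Phi] is defined and
    the absolute values in [rep] change nothing. *)
Lemma Phi_table n (A : 'M[int]_n) (E : int) k a b bt : kk A = k ->
  (forall i, (0 < i <= n)%N -> ainv A i = (a i)%:Z) -> cval A = b%:Z ->
  beta A E = bt%:Z -> is_table n k a b bt -> Phi A E = Some (table_config n k a b bt).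
Proof.
move=> kE aE bE btE [lekn alt ltak ltakb ltbeta]; rewrite /Phi.
have -> : all (fun i => all (fun x => 0 <= x) (exps A E i)) (iota 1 n).
  apply/allP => i; rewrite mem_iota => i_n; have {}i_n : (0 < i <= n)%N by lia.
  rewrite /exps kE /bval bE btE (aE i i_n); have := alt i i_n.
  case: (eqVneq i k.-1) => [->|_] /=; first by lia.
  by case: (eqVneq i k) => [->|_] /=; lia.
congr Some; apply/eq_in_map => i; rewrite mem_iota => i_n.
have {}i_n : (0 < i <= n)%N by lia.
rewrite /word kE /bval bE btE (aE i i_n) /rep /table_word /table_left /table_right /=.
have := alt i i_n; case: (eqVneq i k.-1) => [->|_] alti.
  have -> : (k.-1 == k) = false by lia.
  by congr (_ ++ (_ ++ _ :: nseq _ _)); lia.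
case: (eqVneq i k) alti => [->|_] alti; rewrite -?catA ?cat_cons.
  by congr (_ ++ _ :: (_ ++ nseq _ _)); lia.
by congr (_ ++ nseq _ _); lia.
Qed.

Lemma eq_table_config n k (a1 a2 : nat -> nat) b bt :
  (forall i, (0 < i <= n)%N -> a1 i = a2 i) ->
  table_config n k a1 b bt = table_config n k a2 b bt.
Proof.
move=> ea; apply/eq_in_map => i; rewrite mem_iota => i_n.
by rewrite /table_word /table_left /table_right ea //; lia.
Qed.

(** The inequalities translate as follows: [a k.-1 < a k] is [lehmer_opening_le], [a k + b < k.-1]
    is the bound on the Lehmer code at [x], and the bounds on [E] give [beta >= 0] and
    [a k.-1 + beta < a k + b]. *)
Lemma asm_of_table n (p : {perm 'I_n}) (u x m : 'I_n) (E : int) :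
  let A := asm_of p u x m in
  neutral_data p u x m -> - ell A <= E <= cval A ->
  exists (a : nat -> nat) (b bt : nat),
  [/\ is_table n (n - u) a b bt, Phi A E = Some (table_config n (n - u) a b bt),
      forall i : 'I_n, a (n - i)%N = if i == u then (rank_below p x m).+1
                                     else if i == x then lehmer p u else lehmer p i,
      lehmer p x = (a (n - u) + b)%N &
      E = bt%:Z + (lehmer p u)%:Z - (rank_below p x m)%:Z].
Proof.
move=> A D hE; pose a i := `|ainv A i|%N.
have aE (i : 'I_n) : a (n - i)%N = if i == u then (rank_below p x m).+1
    else if i == x then lehmer p u else lehmer p i.
  by rewrite /a asm_of_ainv.
have aP i : (0 < i <= n)%N -> ainv A i = (a i)%:Z.
  move=> i_n; have lt : (n - i < n)%N by lia.
  have -> : i = (n - Ordinal lt)%N by rewrite /=; lia.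
  by rewrite aE asm_of_ainv.
have xE : x = u.+1 :> nat by case/and4P: D => /eqP.
have xu : (x == u) = false by rewrite -val_eqE /=; lia.
have bE := lehmer_closing D; have eE := asm_of_ell D.
have b0 := asm_of_cval_ge0 D; have le := lehmer_opening_le D.
rewrite -/A in bE eE b0.
have au : a (n - u)%N = (rank_below p x m).+1 by rewrite aE eqxx.
have ax : a (n - u).-1 = lehmer p u.
  have -> : (n - u).-1 = (n - x)%N by lia.
  by rewrite aE eqxx xu.
have ltx := lehmer_lt p x.
have T : is_table n (n - u) a (absz (cval A)) (absz (E + ell A)).
  split; rewrite ?au ?ax; try by lia.
  move=> i i_n; have lt : (n - i < n)%N by lia.
  have {1}-> : i = (n - Ordinal lt)%N by rewrite /=; lia.
  rewrite aE; case: eqP => [/(congr1 val) /= e|_]; first by lia.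
  case: eqP => [/(congr1 val) /= e|_]; first by lia.
  by have := lehmer_lt p (Ordinal lt); rewrite /=; lia.
exists a, (absz (cval A)), (absz (E + ell A)); split=> //; try by lia.
apply: Phi_table => //; rewrite ?/beta; try by lia.
by rewrite /kk asm_of_opening_row // subSS.
Qed.

Lemma table_asm_of n k a b bt : is_table n k a b bt ->
  exists (p : {perm 'I_n}) (u x m : 'I_n),
  [/\ neutral_data p u x m, k = (n - u)%N,
      forall i : 'I_n, a (n - i)%N = if i == u then (rank_below p x m).+1
                                     else if i == x then lehmer p u else lehmer p i &
      lehmer p x = (a k + b)%N].
Proof.
move=> [lekn alt ltak ltakb ltbt].
have lt_u : (n - k < n)%N by lia.
have lt_x : ((n - k).+1 < n)%N by lia.
pose u := Ordinal lt_u; pose x := Ordinal lt_x.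
have xu : (x == u) = false by rewrite -val_eqE /=; lia.
(* The Lehmer code to realize; [a k] itself is encoded afterwards by the choice of [m], of rank
   [a k - 1]. *)
pose c (i : 'I_n) := if i == u then a k.-1 else if i == x then (a k + b)%N else a (n - i)%N.
have ltc i : (c i < n - i)%N.
  rewrite /c; case: eqP => [->|_] /=; first by lia.
  case: eqP => [->|_] /=; first by lia.
  by apply: alt; have := ltn_ord i; lia.
have [p pE] := lehmer_surj ltc.
have pu : lehmer p u = a k.-1 by rewrite pE /c eqxx.
have px : lehmer p x = (a k + b)%N by rewrite pE /c xu eqxx.
have [|m ltxm mE] := @rank_below_surj n p x (a k).-1; first by rewrite /=; lia.
(* If [p x <= p m], comparing counts gives [a k + b <= a k - 1]. *)
have lt_pm_px : (p m < p x)%N.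
  rewrite ltnNge; apply/negP => le.
  have : (lehmer p x <= rank_below p x m)%N.
    apply: subset_leq_card; apply/subsetP => j; rewrite !inE => /andP[-> lt] /=.
    exact: leq_trans lt le.
  by rewrite px mE; lia.
(* If [p m < p u], then [lehmer p u] counts [m] besides all rows counted by the rank, so
   [a k - 1 < a k.-1], against [a k.-1 < a k]. *)
have lt_pu_pm : (p u < p m)%N.
  have um : p u != p m by rewrite (inj_eq perm_inj) -val_eqE /=; move: ltxm => /=; lia.
  rewrite ltn_neqAle um leqNgt; apply/negP => lt.
  have : (rank_below p x m < lehmer p u)%N.
    apply: proper_card; rewrite properE; apply/andP; split.
      apply/subsetP => j; rewrite !inE /= => /andP[lt_j lt_pj].
      by rewrite (ltn_trans lt_pj lt) andbT; lia.
    apply/negP => /subsetP/(_ m); rewrite !inE ltnn andbF lt andbT /=.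
    by move: ltxm => /= ltxm; rewrite ltnW // => /(_ isT).
  by rewrite pu mE; lia.
exists p, u, x, m; split=> //; first by rewrite /neutral_data ltxm lt_pu_pm lt_pm_px /= eqxx.
  by rewrite /=; lia.
move=> i; case: (eqVneq i u) => [->|iu]; first by rewrite mE /= subKn // prednK; lia.
case: (eqVneq i x) => [->|ix]; last by rewrite pE /c (negbTE iu) (negbTE ix).
by rewrite pu /=; congr a; lia.
Qed.

Theorem theorem3 (n : nat) :
  (forall (A : 'M[int]_n) (E : int), in_N A E ->
     exists ws, Phi A E = Some ws /\ in_M n 1 ws) /\
  (forall (A1 A2 : 'M[int]_n) (E1 E2 : int), in_N A1 E1 -> in_N A2 E2 ->
     Phi A1 E1 = Phi A2 E2 -> A1 = A2 /\ E1 = E2) /\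
  (forall ws, in_M n 1 ws ->
     exists (A : 'M[int]_n) (E : int), in_N A E /\ Phi A E = Some ws).
Proof.
split; [|split].
- move=> A E /and3P[A1 neu hE].
  have [p [u [x [m [D eA]]]]] := neutral_asm_of A1 neu; rewrite {}eA in hE *.
  have [a [b [bt [T PhiE _ _ _]]]] := asm_of_table D hE.
  by exists (table_config n (n - u) a b bt); split; last exact: table_config_in_M.
- move=> A1 A2 E1 E2 /and3P[in1 neu1 hE1] /and3P[in2 neu2 hE2].
  have [p1 [u1 [x1 [m1 [D1 eA1]]]]] := neutral_asm_of in1 neu1.
  have [p2 [u2 [x2 [m2 [D2 eA2]]]]] := neutral_asm_of in2 neu2.
  rewrite {A1 in1 neu1}eA1 in hE1 *; rewrite {A2 in2 neu2}eA2 in hE2 *.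
  have [a1 [b1 [bt1 [T1 -> aE1 lx1 ->]]]] := asm_of_table D1 hE1.
  have [a2 [b2 [bt2 [T2 -> aE2 lx2 ->]]]] := asm_of_table D2 hE2.
  (* Equal tables determine the data in turn: [k] gives [u] and [x], the entries give the Lehmer
     code and so [p], then [a k] gives [m] through its rank, and [beta] gives [E]. *)
  move=> [/(table_config_inj T1 T2) [ek ea eb ebt]].
  have eu : u1 = u2 by apply: val_inj => /=; have := ltn_ord u1; have := ltn_ord u2; lia.
  have [/eqP x1E lt1 _ _] := and4P D1; have [/eqP x2E lt2 _ _] := and4P D2.
  have ex : x1 = x2 by apply: val_inj => /=; rewrite x1E x2E eu.
  subst u1 x1.
  have xu : (x2 == u2) = false by rewrite -val_eqE /=; lia.
  have ea' (i : 'I_n) : a1 (n - i)%N = a2 (n - i)%N.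
    by apply: ea; have := ltn_ord i; lia.
  have eu : lehmer p1 u2 = lehmer p2 u2.
    by have := ea' x2; rewrite aE1 aE2 eqxx xu.
  have em : rank_below p1 x2 m1 = rank_below p2 x2 m2.
    by have := ea' u2; rewrite aE1 aE2 eqxx => -[].
  have ep : p1 = p2.
    apply: lehmer_inj => i; case: (eqVneq i u2) => [->|iu] //.
    case: (eqVneq i x2) => [->|ix]; first by rewrite lx1 lx2 ea' eb.
    by have := ea' i; rewrite aE1 aE2 (negbTE iu) (negbTE ix).
  subst p1.
  by rewrite (rank_below_inj lt1 lt2 em) ebt.
- move=> ws /in_M_table[k [a [b [bt [T ->]]]]].
  have [p [u [x [m [D kE aE lx]]]]] := table_asm_of T.
  pose A := asm_of p u x m.
  pose E := bt%:Z + (lehmer p u)%:Z - (rank_below p x m)%:Z.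
  have [lekn alt ltak ltakb ltbt] := T.
  have xE : x = u.+1 :> nat by case/and4P: D => /eqP.
  have xu : (x == u) = false by rewrite -val_eqE /=; lia.
  have au : a k = (rank_below p x m).+1 by rewrite kE aE eqxx.
  have ax : a k.-1 = lehmer p u.
    have -> : k.-1 = (n - x)%N by lia.
    by rewrite aE eqxx xu.
  (* The lower bound is [bt >= 0]; the upper one is [a k.-1 + bt < a k + b]. *)
  have hE : - ell A <= E <= cval A.
    have := lehmer_closing D; rewrite asm_of_ell // -/A /E lx.
    by lia.
  exists A, E; split.
    by apply/and3P; split; [exact: asm_of_in_A1 | exact: asm_of_neutral | ].
  have [a' [b' [bt' [T' -> aE' lx' eE]]]] := asm_of_table D hE.
  (* The two functions need only agree on [1..n], the indices of the paths. *)
  have ea i : (0 < i <= n)%N -> a' i = a i.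
    move=> i_n; have lt : (n - i < n)%N by lia.
    have -> : i = (n - Ordinal lt)%N by rewrite /=; lia.
    by rewrite aE aE'.
  rewrite -kE in lx' *; rewrite (eq_table_config k b' bt' ea).
  have -> : b' = b by move: lx'; rewrite lx ea; lia.
  by have -> : bt' = bt by move: eE; rewrite /E; lia.
Qed.
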